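(* Let $\sigma\le\tau$ in $\mathcal{P}$. The interval $[\sigma,\tau]$ in $\mathcal{P}$ is shellable if and only if it contains no non-trivial disconnected subintervals.
   Context: $\mathcal{S}_n$ is the set of permutations of $\{1,\dots,n\}$ in one-line notation $\tau=\tau_1\tau_2\dots\tau_n$, with $|\tau|=n$. The reduction of a sequence of $k$ distinct positive integers is the permutation in $\mathcal{S}_k$ obtained by replacing the smallest entry by $1$, the second smallest by $2$, and so on. For $1\le i\le j\le n$, $\tau_{[i,j]}\in\mathcal{S}_{j-i+1}$ is the reduction of $\tau_i\dots\tau_j$. The consecutive pattern poset $\mathcal{P}$ is the set $\bigcup_{n\ge1}\mathcal{S}_n$ with $\sigma\le\tau$ iff $\sigma=\tau_{[i,j]}$ for some $i\le j$. For $\sigma\le\tau$, $[\sigma,\tau]=\{\pi:\sigma\le\pi\le\tau\}$ and $(\sigma,\tau)=\{\pi:\sigma<\pi<\tau\}$; the rank of $[\sigma,\tau]$ is $|\tau|-|\sigma|$. The order complex $\Delta(\sigma,\tau)$ is the simplicial complex whose faces are the chains of $(\sigma,\tau)$; it is pure (all facets have the same dimension). A shelling of a pure $d$-dimensional simplicial complex is a linear ordering $F_1,\dots,F_s$ of its facets such that, regarding each facet as the subcomplex of all its faces, $\left(\bigcup_{j=1}^{k-1}F_j\right)\cap F_k$ is pure and $(d-1)$-dimensional for all $k=2,\dots,s$. A complex is shellable if it has a shelling, and $[\sigma,\tau]$ is shellable if $\Delta(\sigma,\tau)$ is. An interval is disconnected if its order complex is disconnected; equivalently, the Hasse diagram of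 the corresponding open interval is disconnected. A disconnected interval is non-trivial if it has rank at least $3$. A subinterval of $[\sigma,\tau]$ is an interval $[\alpha,\beta]$ with $\sigma\le\alpha\le\beta\le\tau$. *)

(* Defs.v *)
From HB Require Import structures.
From mathcomp Require Import all_boot all_order all_algebra finmap.
From mathcomp Require Import zify.
Set Implicit Arguments.
Unset Strict Implicit.
Unset Printing Implicit Defensive.
Import Order.TTheory.

(* One-line notation of a permutation of {1, ..., n} for some n >= 1. *)
Definition is_oneline (s : seq nat) : bool :=
  (0 < size s) && perm_eq s (iota 1 (size s)).

Record cperm : Type := CPerm {oneline :> seq nat; _ : is_oneline oneline}.

HB.instance Definition _ := [isSub for oneline].
HB.instance Definition _ := [Countable of cperm by <:].

(* The number of entries y <= x is the position of x (counted from 1) when the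
   distinct entries are listed in increasing order. *)
Definition reduction (s : seq nat) : seq nat :=
  [seq count (fun y => y <= x) s | x <- s].

(* [window t i j] is t_[i,j]; positions are counted from 1. *)
Definition window (t : seq nat) (i j : nat) : seq nat :=
  reduction (drop i.-1 (take j t)).

Definition cperm_le (s t : cperm) : bool :=
  [exists i : 'I_(size t), exists j : 'I_(size t),
     (i <= j) && (oneline s == window t i.+1 j.+1)].

Lemma cperm_leP (s t : cperm) :
  reflect (exists i j, [/\ 1 <= i, i <= j, j <= size t
                         & oneline s = window t i j])
          (cperm_le s t).
Proof.
apply: (iffP existsP) => [[i /existsP[j /andP[ij /eqP ->]]]|].
  by exists i.+1, j.+1; split.
move=> [[|i] [[|j] []]] // _ ij jt st.
exists (Ordinal (leq_trans ij jt : i < size t)); apply/existsP.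
by exists (Ordinal (jt : j < size t)); rewrite /= -ltnS ij st eqxx.
Qed.

Lemma size_reduction s : size (reduction s) = size s.
Proof. by rewrite size_map. Qed.

Lemma size_window t i j : 1 <= i -> j <= size t -> size (window t i j) = j.+1 - i.
Proof.
by case: i => // i _ jt; rewrite size_reduction size_drop size_takel ?subSS.
Qed.

Lemma reduction_oneline s : is_oneline s -> reduction s = s.
Proof.
move=> /andP[_ ps]; rewrite /reduction -[RHS]map_id; apply/eq_in_map => x.
rewrite (perm_mem ps) mem_iota (permP ps) => /andP[x0 xs].
have -> : iota 1 (size s) = iota 1 x ++ iota (1 + x) (size s - x).
  by rewrite -iotaD subnKC //; lia.
rewrite count_cat (eq_in_count (a2 := predT)); last first.
  by move=> y; rewrite mem_iota => ?; rewrite /=; lia.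
rewrite count_predT size_iota (eq_in_count (a2 := pred0)) ?count_pred0 ?addn0//.
by move=> y; rewrite mem_iota => ?; rewrite /=; lia.
Qed.

Lemma reduction_map (f : nat -> nat) (s : seq nat) :
  {in s &, {mono f : x y / x <= y}} -> reduction (map f s) = reduction s.
Proof.
move=> fs; rewrite /reduction -map_comp; apply/eq_in_map => x xs /=.
by rewrite count_map; apply/eq_in_count => y ys; apply: fs.
Qed.

Lemma window_full (t : cperm) : window t 1 (size t) = t.
Proof.
by rewrite /window drop0 take_size reduction_oneline //; case: t.
Qed.

Lemma window_window (u : seq nat) i j k l : 1 <= i -> 1 <= k ->
  0 < l <= j.+1 - i -> window (window u i j) k l = window u (i + k).-1 (i + l).-1.
Proof.
case: i k => [|i] [|k] // _ _; rewrite subSS => lj; have [l0 {}lj] := andP lj.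
rewrite {1}/window {1}/window /= /reduction -map_take -map_drop -/(reduction _).
rewrite reduction_map => [|x y].
  rewrite /window take_drop drop_drop take_takel; last by lia.
  by congr (reduction (drop _ (take _ _))); lia.
move=> /mem_drop/mem_take xs /mem_drop/mem_take ys.
apply/idP/idP => [|xy]; last by apply: sub_count => z /= /leq_trans; apply.
apply: contraTT; rewrite -!ltnNge => yx.
set s := drop _ _ in xs ys *.
rewrite -[X in _ < X]size_filter -(count_predC (fun z => z <= y)) !count_filter.
rewrite -addn1 leq_add //.
  by apply: sub_count => z /= zy; rewrite zy (leq_trans zy (ltnW yx)).
by rewrite -has_count; apply/hasP; exists x; rewrite //= -ltnNge yx leqnn.
Qed.

Lemma cperm_le_size (s t : cperm) : cperm_le s t -> size s <= size t.
Proof. by move=> /cperm_leP[i [j [i1 ij jt ->]]]; rewrite size_window //; lia. Qed.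

Lemma cperm_le_refl : reflexive cperm_le.
Proof.
move=> s; apply/cperm_leP; exists 1, (size s); rewrite window_full.
by split=> //; case: s => s /= /andP[].
Qed.

Lemma cperm_le_anti : antisymmetric cperm_le.
Proof.
move=> s t /andP[/cperm_leP[i [j [i1 ij jt st]]] /cperm_le_size ts].
apply/val_inj; rewrite /= st -[RHS]window_full.
by move: ts; rewrite st size_window // => ts; congr window; lia.
Qed.

Lemma cperm_le_trans : transitive cperm_le.
Proof.
move=> t s u /cperm_leP[k [l [k1 kl lt st]]] /cperm_leP[i [j [i1 ij ju tu]]].
move: lt; rewrite tu size_window // => lji.
apply/cperm_leP; exists (i + k).-1, (i + l).-1.
by rewrite st tu window_window //; try split=> //; lia.
Qed.

Fact cperm_display : Order.disp_t. Proof. exact: (Order.Disp tt tt). Qed.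

HB.instance Definition _ := Order.Le_isPOrder.Build cperm_display cperm
  cperm_le_refl cperm_le_anti cperm_le_trans.

(* The rank of the interval [alpha, beta], meant for alpha <= beta. *)
Definition interval_rank (alpha beta : cperm) : nat := size beta - size alpha.

Section Complexes.
Variable V : choiceType.

(* A complex is given by its set of faces; the empty set counts as a face. *)
Implicit Types (C : {pred {fset V}}) (F G : {fset V}) (Fs : seq {fset V}).

(* The empty face has dimension -1. *)
Definition face_dim F : int := (#|` F|%:Z - 1)%R.

Definition facet C F : Prop :=
  F \in C /\ forall G, G \in C -> (F `<=` G)%fset -> G = F.

(* C is pure and d-dimensional. *)
Definition pure_dim C (d : int) : Prop :=
  (exists F, facet C F) /\ forall F, facet C F -> face_dim F = d.

(* The intersection of the subcomplex generated by Fs with the simplex F. *)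
Definition attaching_complex Fs F : {pred {fset V}} :=
  [pred G | has (fun H => G `<=` H)%fset Fs && (G `<=` F)%fset].

(* Indices start at 0, so k ranges over all facets but the first one. *)
Definition shelling C (d : int) Fs : Prop :=
  [/\ uniq Fs,
      forall F, F \in Fs <-> facet C F
    & forall k, 0 < k < size Fs ->
        pure_dim (attaching_complex (take k Fs) (nth fset0 Fs k)) (d - 1)%R].

Definition shellable C : Prop :=
  exists d, pure_dim C d /\ exists Fs, shelling C d Fs.

(* Connectedness of a complex is connectedness of its 1-skeleton. *)
Definition complex_connected C : Prop :=
  forall x y, [fset x]%fset \in C -> [fset y]%fset \in C ->
    exists2 p : seq V, path (fun u v => [fset u; v]%fset \in C) x p
                     & last x p = y.

End Complexes.

Definition order_complex (d : Order.disp_t) (T : porderType d) (a b : T) :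
    {pred {fset T}} :=
  [pred F : {fset T} | [forall x : F, (a < val x < b)%O]
                       && [forall x : F, forall y : F, (val x >=< val y)%O]].

Definition interval_shellable (alpha beta : cperm) : Prop :=
  shellable (order_complex alpha beta).

Definition interval_disconnected (alpha beta : cperm) : Prop :=
  ~ complex_connected (order_complex alpha beta).

Definition nontrivial_disconnected (alpha beta : cperm) : Prop :=
  interval_disconnected alpha beta /\ 3 <= interval_rank alpha beta.

(* Main.v *)
Require Import Defs.
From mathcomp Require Import all_boot all_order ssralg ssrint finmap zify.
From Stdlib Require Import Classical.
Set Implicit Arguments.
Unset Strict Implicit.
Unset Printing Implicit Defensive.
Import Order.TTheory.
Local Open Scope fset_scope.

(** The theorem is a statement about graded posets in which every element
    covers at most two others: a permutation covers only the reductions of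
    itself without its first letter and without its last letter.

    If all intervals of rank at least 3 below b are connected, then the maximal
    chains of (a, b) are shelled recursively.  Let p and s be the coatoms of b
    above a.  List the chains through p first, in the order given by a shelling
    of (a, p), then the chains through s, in the order given by a shelling of
    (a, s) that starts with the chains whose top element is also covered by p.
    Such a shelling of (a, s) exists because the induction lets us choose which
    of the two coatoms of s goes first ([ordered_facets]).  Let a chain C
    through s and a chain D through p be given, with p and s distinct.  If C
    minus s is empty or has a top element covered by p, then replacing s by p in
    C gives an earlier chain that contains the intersection of C and D.
    Otherwise let y be the largest element of that intersection, or a if the
    intersection is empty.  Connectedness yields an element z >= y that both p
    and s cover ([common_coatom]): while the rank of [y, b] is at least 3, a path from p to s in (y, b) must pass through an element
    below both, which replaces y.  Some chain L of (a, s) contains z and the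
    intersection, and precedes C minus s by the choice of the order, so the
    shelling of (a, s) provides the required neighbour of C.

    Conversely, a shelling of (a, b) makes every subinterval (x, y) of rank at
    least 3 connected ([shellable_connected]).  Take a chain K in (a, b) that
    is maximal among those with each element <= x or >= y ([frame_exists]): the
    facets of (a, b) containing K restrict to the maximal chains of (x, y).
    By induction along the shelling, each of them is linked to the first one, since it shares all but one of its
    elements, hence at least one element of (x, y), with an earlier one. *)

(** * Facets and shellings of a complex *)

Section Complexes.
Variable V : choiceType.
Implicit Types (C : {pred {fset V}}) (F G H : {fset V}) (Fs : seq {fset V}).

(** Complexes may live on an infinite set of vertices; a bound on the size of the
    faces is what makes the extension of a face to a facet terminate. *)
Lemma facet_extension C n F : (forall G, G \in C -> #|` G| <= n) -> F \in C ->
  exists2 H, facet C H & F `<=` H.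
Proof.
move=> bound; have [m] := ubnP (n - #|` F|).
elim: m F => // m IHm F; rewrite ltnS => nFm CF.
case: (classic (facet C F)) => [fF | nfF]; first by exists F.
have [G [CG FG]] : exists G, G \in C /\ F `<` G.
  apply: NNPP => noG; apply: nfF; split=> // G CG FG; apply/eqP/negPn/negP => GF.
  by apply: noG; exists G; split; rewrite // fproperEneq eq_sym GF.
have [|//|H fH GH] := IHm G.
  by have := fproper_ltn_card FG; have := bound G CG; lia.
by exists H => //; apply: fsubset_trans GH; apply: fproper_sub.
Qed.

(** Purity, in codimension one, of the intersection of the simplex F with the
    complex generated by Gs, in a form that is stable under coning and does not
    speak of the facets of that intersection. *)
Definition attaches (Gs : seq {fset V}) F := forall G, G \in Gs ->
  exists2 H, H \in Gs & G `&` F `<=` H /\ #|` H `&` F|.+1 = #|` F|.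

Definition exchange Fs := forall k, k < size Fs ->
  attaches (take k Fs) (nth fset0 Fs k).

Lemma exchange_cat Fs1 Fs2 : exchange Fs1 ->
    (forall k, k < size Fs2 -> attaches (Fs1 ++ take k Fs2) (nth fset0 Fs2 k)) ->
  exchange (Fs1 ++ Fs2).
Proof.
move=> ex1 ex2 k; rewrite size_cat take_cat nth_cat => k_lt.
case: ltnP => [k1 | k1]; first exact: (ex1 k k1).
by apply: (ex2 (k - size Fs1)); lia.
Qed.

Lemma cardfsI_cone c F H : c \notin F -> c \notin H ->
  #|` (c |` H) `&` (c |` F)| = #|` H `&` F|.+1.
Proof. by move=> cF cH; rewrite -fsetUIr cardfsU1 inE (negPf cF) andbF. Qed.

Lemma attaches_cone c (Gs : seq {fset V}) F :
    c \notin F -> (forall G, G \in Gs -> c \notin G) ->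
  attaches Gs F -> attaches [seq c |` G | G <- Gs] (c |` F).
Proof.
move=> cF cGs att _ /mapP[G GsG ->]; have [H GsH [sub cardH]] := att G GsG.
exists (c |` H); first exact: map_f.
have cH := cGs H GsH.
by split; [rewrite -fsetUIr fsetUS | rewrite cardfsI_cone // cardH cardfsU1 cF].
Qed.

Lemma exchange_cone c Fs : (forall F, F \in Fs -> c \notin F) ->
  exchange Fs -> exchange [seq c |` F | F <- Fs].
Proof.
move=> cFs ex k; rewrite size_map => k_lt; rewrite -map_take (nth_map fset0) //.
apply: attaches_cone; [exact/cFs/mem_nth | | exact: (ex k)].
by move=> G /mem_take; apply: cFs.
Qed.

(** By the exchange condition, the facets of the attaching complex are among the
    intersections of codimension one; such an intersection is a facet because
    only F itself could properly contain it, and F is not a face of an earlier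
    facet. *)
Lemma shelling_exchange C d Fs : uniq Fs -> (forall F, F \in Fs <-> facet C F) ->
  (forall F, F \in Fs -> face_dim F = d) -> exchange Fs -> shelling C d Fs.
Proof.
move=> uFs FsE dimFs ex; split=> // k /andP[k0 k_lt].
set F := nth _ _ _; have FsF : F \in Fs by apply: mem_nth.
have att := ex k k_lt; rewrite -/F in att.
have codim1 H : #|` H|.+1 = #|` F| -> face_dim H = (d - 1)%R.
  by move=> cardH; rewrite -(dimFs F FsF) /face_dim -cardH; lia.
have facetI H : H \in take k Fs -> #|` H `&` F|.+1 = #|` F| ->
    facet (attaching_complex (take k Fs) F) (H `&` F).
  move=> tH cardH; split.
    by rewrite inE fsubsetIr andbT; apply/hasP; exists H; rewrite ?fsubsetIl.
  move=> G; rewrite inE => /andP[/hasP[E tE GE] GF] HG.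
  apply/eqP; rewrite eq_sym eqEfcard HG -ltnS cardH ltn_neqAle.
  rewrite fsubset_leq_card // andbT; apply: contraTneq (tE) => GFcard.
  have GFE : G = F by apply/eqP; rewrite eqEfcard GF GFcard leqnn.
  have EF : E = F.
    have [_ maxF] := (FsE F).1 FsF.
    by case: ((FsE E).1 (mem_take tE)) => CE _; apply: maxF; rewrite // -GFE.
  apply/negP => /(nthP fset0)[i]; rewrite size_takel ?(ltnW k_lt) // => ik.
  rewrite nth_take // EF => /eqP; rewrite nth_uniq ?(ltn_trans ik) //.
  by rewrite (ltn_eqF ik).
split.
  have [|H tH [_ cardH]] := att (nth fset0 Fs 0).
    by rewrite -(nth_take _ k0) mem_nth // size_takel // ltnW.
  by exists (H `&` F); apply: facetI.
move=> G [aG maxG]; move: (aG); rewrite inE => /andP[/hasP[E tE GE] GF].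
have [H tH [EH cardH]] := att E tE; have [aHF _] := facetI H tH cardH.
rewrite -(maxG _ aHF) ?codim1 //.
by rewrite fsubsetI GF andbT (fsubset_trans _ EH) // fsubsetI GE.
Qed.

End Complexes.

(** * Chains in a graded poset *)

Section Poset.
Context {disp : Order.disp_t} {T : porderType disp}.
Variables (rank : T -> nat) (low : T -> seq T).
(* [low b] lists the elements covered by b. *)
Hypothesis ltE : forall a b : T, (a < b)%O = has (fun c => (a <= c)%O) (low b).
Hypothesis rank_low : forall b c : T, c \in low b -> rank b = (rank c).+1.
Implicit Types (a b c p s x y z : T) (F G H : {fset T}).

Lemma order_complexP a b F :
  reflect ((forall x, x \in F -> (a < x < b)%O) /\
           (forall x y, x \in F -> y \in F -> (x >=< y)%O))
          (F \in order_complex a b).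
Proof.
apply: (iffP andP) => [[/forallP ab /forallP cmp] | [ab cmp]]; last first.
  split; apply/forallP => x; first exact: ab (valP x).
  by apply/forallP => y; apply: cmp (valP x) (valP y).
split=> [x xF | x y xF yF]; first exact: (ab [` xF]).
by have /forallP/(_ [` yF]) := cmp [` xF].
Qed.

Lemma order_complex_sub a b F G :
  G `<=` F -> F \in order_complex a b -> G \in order_complex a b.
Proof.
move=> /fsubsetP GF /order_complexP[ab cmp]; apply/order_complexP.
by split=> [x /GF/ab // | x y /GF xF /GF]; apply: cmp.
Qed.

Lemma order_complex_fset0 a b : fset0 \in order_complex a b.
Proof. by apply/order_complexP; split. Qed.

Lemma order_complexU a b F G :
    F \in order_complex a b -> G \in order_complex a b ->
    (forall x y, x \in F -> y \in G -> (x >=< y)%O) ->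
  F `|` G \in order_complex a b.
Proof.
move=> /order_complexP[abF cmpF] /order_complexP[abG cmpG] cmp.
apply/order_complexP; split=> [x | x y]; rewrite !inE.
  by case/orP; [apply: abF | apply: abG].
case/orP=> [xF|xG] /orP[yF|yG]; first exact: cmpF.
- exact: cmp.
- by rewrite comparable_sym cmp.
- exact: cmpG.
Qed.

Lemma order_complex1 a b x : ([fset x] \in order_complex a b) = (a < x < b)%O.
Proof.
apply/order_complexP/idP => [[ab _] | axb]; first by apply: ab; rewrite inE.
by split=> [y | y z]; rewrite !inE => /eqP-> //; move/eqP->; apply: comparablexx.
Qed.

Lemma order_complex2 a b x y :
  ([fset x; y] \in order_complex a b) =
  [&& (a < x < b)%O, (a < y < b)%O & (x >=< y)%O].
Proof.
apply/order_complexP/and3P => [[ab cmp] | [ax ay xy]].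
  by split; [apply: ab | apply: ab | apply: cmp]; rewrite !inE eqxx ?orbT.
split=> [z | z t]; rewrite !inE; first by case/orP=> /eqP->.
by case/orP=> /eqP-> /orP[] /eqP->; rewrite ?comparablexx // comparable_sym.
Qed.

Lemma order_complex_cone a b c F : (a < c < b)%O -> F \in order_complex a c ->
  c |` F \in order_complex a b.
Proof.
move=> acb /order_complexP[ac cmp]; have /andP[_ cb] := acb.
apply: order_complexU; first by rewrite order_complex1.
  apply/order_complexP; split=> // x /ac /andP[-> xc]; exact: lt_trans cb.
by move=> x y; rewrite inE => /eqP-> /ac/andP[_ /ltW/ge_comparable].
Qed.

Lemma low_lt b c : c \in low b -> (c < b)%O.
Proof. by move=> lc; rewrite ltE; apply/hasP; exists c. Qed.

Lemma rank_lt a b : (a < b)%O -> rank a < rank b.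
Proof.
have [n] := ubnP (rank b); elim: n b => // n IHn b; rewrite ltnS => rb.
rewrite ltE => /hasP[c lc]; rewrite le_eqVlt => /predU1P[-> | ac].
  by rewrite (rank_low lc).
have rc := rank_low lc; have := IHn c _ ac; lia.
Qed.

Lemma rank_le a b : (a <= b)%O -> rank a <= rank b.
Proof. by rewrite le_eqVlt => /predU1P[-> // | /rank_lt/ltnW]. Qed.

Lemma rank_inj a b : (a <= b)%O -> rank b <= rank a -> a = b.
Proof. by rewrite le_eqVlt => /predU1P[//|/rank_lt]; rewrite ltnNge => /negPf->. Qed.

Lemma card_chain a b F : F \in order_complex a b -> #|` F| <= rank b.
Proof.
case/order_complexP=> ab cmp.
rewrite -(size_map rank) -(size_iota 0 (rank b)); apply: uniq_leq_size.
  rewrite map_inj_in_uniq ?fset_uniq // => x y xF yF rxy.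
  have /orP[xy | yx] := cmp x y xF yF; first by apply: rank_inj; rewrite ?rxy.
  by apply/esym/rank_inj; rewrite ?rxy.
move=> _ /mapP[x xF ->]; rewrite mem_iota /=.
by have /andP[_ /rank_lt] := ab x xF.
Qed.

Lemma facet_order_complex a b F : F \in order_complex a b ->
  exists2 H, facet (order_complex a b) H & F `<=` H.
Proof. apply: facet_extension => G; exact: card_chain. Qed.

(** For the empty chain, the lower end a takes the place of the maximum. *)
Lemma chain_max a b F : F \in order_complex a b ->
  exists2 m, m = a \/ m \in F & (a <= m)%O /\ forall x, x \in F -> (x <= m)%O.
Proof.
case/order_complexP => ab cmp.
suff: forall r : seq T, {subset r <= F} -> exists2 m, m = a \/ m \in F &
    (a <= m)%O /\ forall x, x \in r -> (x <= m)%O by apply.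
elim=> [_ | x r IHr sub]; first by exists a; [left | split].
have [|m mF [am mr]] := IHr; first by move=> y yr; rewrite sub // inE yr orbT.
have xF : x \in F by rewrite sub // mem_head.
have mx : (m >=< x)%O.
  by case: mF => [-> | mF]; [have /andP[/ltW/le_comparable] := ab x xF | apply: cmp].
case/orP: mx => [mx | xm].
  exists x; [by right | split; first exact: le_trans mx].
  by move=> y; rewrite inE => /predU1P[-> // | /mr ym]; apply: le_trans mx.
exists m => //; split=> // y; rewrite inE => /predU1P[-> // | /mr //].
Qed.

(** A maximal chain has its top element among the coatoms of b, and what is left
    is a maximal chain below that coatom.  Rank at least 2 excludes the interval
    whose only coatom is a itself. *)
Lemma facet_coneP a b F : (rank a).+1 < rank b -> (a <= b)%O ->
  facet (order_complex a b) F <->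
  exists c G, [/\ c \in low b, (a < c)%O, facet (order_complex a c) G
                & F = c |` G].
Proof.
move=> rab ab.
have lowS y : (y < b)%O -> (a <= y)%O ->
    exists c, [/\ c \in low b, (y <= c)%O & (a < c)%O].
  rewrite ltE => /hasP[c lc yc] ay; exists c; split=> //.
  rewrite lt_neqAle (le_trans ay yc) andbT; apply: contraTneq rab => ->.
  by rewrite (rank_low lc) ltnn.
split=> [[cF maxF] | [c [G [lc ac [cG maxG] ->]]]]; last first.
  have cb := low_lt lc; split; first by rewrite order_complex_cone ?ac.
  move=> E /order_complexP[Eab Ecmp] /fsubsetP sub.
  have cE : c \in E by apply: sub; rewrite !inE eqxx.
  rewrite -(fsetD1K cE); congr (_ |` _); apply: maxG; last first.
    apply/fsubsetP => x xG; rewrite !inE sub ?inE ?xG ?orbT // andbT.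
    apply: contraTneq xG => ->; apply/negP => /(order_complexP _ _ _ cG).1.
    by rewrite ltxx andbF.
  apply/order_complexP; split=> [x | x y]; rewrite !inE; last first.
    by move=> /andP[_ xE] /andP[_ yE]; apply: Ecmp.
  move=> /andP[xc xE]; have /andP[-> /rank_lt xb] := Eab x xE.
  have := Ecmp x c xE cE; rewrite lt_neqAle xc /= => /orP[// | cx].
  have := @rank_lt c x; rewrite lt_neqAle eq_sym xc cx => /(_ isT).
  by move: (rank_low lc) xb; clear; lia.
have [m mF [am Fm]] := chain_max cF.
have mb : (m < b)%O.
  case: mF => [-> | mF]; last by have /order_complexP[/(_ m mF)/andP[]] := cF.
  by rewrite lt_neqAle ab andbT; apply: contraTneq rab => ->; rewrite -leqNgt.
have [c [lc mc ac]] := lowS m mb am; have cb := low_lt lc.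
have /order_complexP[Fab Fcmp] := cF.
have cF' : c \in F.
  suff <- : c |` F = F by rewrite !inE eqxx.
  apply: maxF; last exact: fsubsetUr.
  apply: order_complexU; rewrite ?order_complex1 ?ac //.
  by move=> x y; rewrite inE => /eqP-> /Fm ym; apply/ge_comparable/(le_trans ym).
exists c, (F `\ c); split=> //; last by rewrite fsetD1K.
split.
  apply/order_complexP; split=> [x | x y]; rewrite !inE; last first.
    by move=> /andP[_ xF] /andP[_ yF]; apply: Fcmp.
  move=> /andP[xc xF]; have /andP[-> _] := Fab x xF.
  by rewrite lt_neqAle xc (le_trans (Fm x xF)).
move=> G cG FG; rewrite -[F](maxF (c |` G)).
- rewrite fsetU1K //.
  by apply/negP => /(order_complexP _ _ _ cG).1; rewrite ltxx andbF.
- by rewrite order_complex_cone ?ac.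
- by rewrite -(fsetD1K cF') fsetUS.
Qed.

Lemma facet_fset0 a b F : rank b <= (rank a).+1 ->
  facet (order_complex a b) F <-> F = fset0.
Proof.
move=> rab.
have no G : G \in order_complex a b -> G = fset0.
  move=> /order_complexP[ab _]; apply/eqP; apply/fset0Pn => -[x /ab].
  by move=> /andP[/rank_lt ax /rank_lt]; lia.
split=> [[/no] // | ->]; split=> [|G /no-> //]; exact: order_complex_fset0.
Qed.

Lemma card_facet a b F : (a <= b)%O -> facet (order_complex a b) F ->
  #|` F| = (rank b - rank a).-1.
Proof.
have [n] := ubnP (rank b); elim: n b F => // n IHn b F; rewrite ltnS => rb ab.
have [rab | rab] := leqP (rank b) (rank a).+1.
  by rewrite facet_fset0 // => ->; rewrite cardfs0; lia.
rewrite facet_coneP // => -[c [G [lc ac fG ->]]]; have rc := rank_low lc.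
rewrite cardfsU1 (IHn c) ?(ltW ac) //; last by lia.
have -> : c \notin G.
  by apply/negP => /(order_complexP _ _ _ fG.1).1; rewrite ltxx andbF.
have := rank_lt ac; lia.
Qed.

(** * Shelling when every element covers at most two others *)

Section TwoCoatoms.
Hypothesis size_low : forall b, size (low b) <= 2.

Lemma two_coatoms b p s c : p != s -> p \in low b -> s \in low b -> c \in low b ->
  c = p \/ c = s.
Proof.
have := size_low b; case: (low b) => [|x [|y [|? ?]]] //= _; rewrite !inE.
  by move=> /eqP ps /eqP pE /eqP sE; case: ps; rewrite pE.
move=> ps /orP[]/eqP pE /orP[]/eqP sE /orP[]/eqP cE; move: ps;
  by rewrite pE sE cE ?eqxx //; auto.
Qed.

(** The two coatoms coincide when only one of them lies above a; when they
    differ, they are numbered so that p has the property q as soon as one of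
    them has it. *)
Lemma coatom_pair a b (q : pred T) : (rank a).+1 < rank b -> (a <= b)%O ->
  exists p s, [/\ p \in low b /\ s \in low b, (a < p)%O /\ (a < s)%O,
    forall c, c \in low b -> (a < c)%O -> c = p \/ c = s & q s -> q p].
Proof.
move=> rab ab.
have [c lc ac] : exists2 c, c \in low b & (a < c)%O.
  have : (a < b)%O.
    by rewrite lt_neqAle ab andbT; apply: contraTneq rab => ->; lia.
  rewrite ltE => /hasP[c lc ac]; exists c => //.
  rewrite lt_neqAle ac andbT; apply: contraTneq rab => ->.
  by rewrite (rank_low lc) ltnn.
have [/hasP[e le /andP[ae ec]] | /hasPn onlyc] :=
    boolP (has (fun e => (a < e)%O && (e != c)) (low b)); last first.
  exists c, c; split=> // e le ae; left; apply/eqP.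
  by have := onlyc e le; rewrite ae negbK.
have [qc | qc] := boolP (q c).
  by exists c, e; split=> // x lx _; apply: (two_coatoms _ lc le lx); rewrite eq_sym.
exists e, c; split=> // [x lx _ | ]; last by rewrite (negPf qc).
exact: two_coatoms ec le lc lx.
Qed.

(** In rank 2 the element y is itself covered by p and s.  In higher rank, a path
    from p to s in (y, b) leaves the elements below p at some point, and it can
    do so only at an element below both p and s; this element replaces y. *)
Lemma common_coatom a b p s y :
    (forall x, (a <= x)%O -> (x <= b)%O -> 3 <= rank b - rank x ->
       complex_connected (order_complex x b)) ->
    p \in low b -> s \in low b -> p != s ->
    (a <= y)%O -> (y <= p)%O -> (y <= s)%O ->
  exists z, [/\ z \in low p, z \in low s & (y <= z)%O].
Proof.
move=> conn lp ls ps; have [n] := ubnP (rank b - rank y).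
elim: n y => // n IHn y; rewrite ltnS => ryb ay yp ys.
have [rp rs] := (rank_low lp, rank_low ls).
have ltyp : (y < p)%O.
  rewrite lt_neqAle yp andbT; apply: contraNneq ps => yE.
  by apply/eqP/rank_inj; [rewrite -yE | lia].
have ltys : (y < s)%O.
  rewrite lt_neqAle ys andbT; apply: contraNneq ps => yE.
  by apply/eqP/esym/rank_inj; [rewrite -yE | lia].
have [rys ryp] := (rank_lt ltys, rank_lt ltyp).
have [pb sb] := (low_lt lp, low_lt ls).
have [r3 | r2] := leqP 3 (rank b - rank y); last first.
  have eqy c z : rank c = rank p -> z \in low c -> (y <= z)%O -> y \in low c.
    move=> rc lz yz; rewrite (rank_inj yz) //.
    by move: rc rp r2 (rank_low lz); clear; lia.
  move: ltyp ltys; rewrite !ltE => /hasP[z lz yz] /hasP[t lt yt].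
  exists y; split; [exact: eqy lz yz | apply: eqy lt yt | by []].
  by apply: succn_inj; rewrite -rs rp.
have [||r path_r last_r] := conn y ay (ltW (le_lt_trans yp pb)) r3 p s.
- by rewrite order_complex1 ltyp.
- by rewrite order_complex1 ltys.
have [w [yw wp ws]] : exists w, [/\ (y < w)%O, (w <= p)%O & (w <= s)%O].
  suff walk u : path (fun v w => [fset v; w] \in order_complex y b) u r ->
      last u r = s -> (y < u <= p)%O ->
      exists w, [/\ (y < w)%O, (w <= p)%O & (w <= s)%O].
    by apply: walk path_r last_r _; rewrite ltyp lexx.
  elim: r u {path_r last_r} => [|v r IHr] u /=.
    by move=> _ -> /andP[ys' sp]; exists s; split; rewrite ?lexx.
  rewrite order_complex2 => /andP[/and3P[_ /andP[yv vb] uv] path_r] last_r.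
  move=> /andP[yu up].
  have [vp | vp] := boolP (v <= p)%O; first by apply: (IHr v path_r last_r); rewrite yv.
  move: vb; rewrite ltE => /hasP[c lc vc].
  have [cE | cE] := two_coatoms ps lp ls lc; first by rewrite cE (negPf vp) in vc.
  case/orP: uv => [uv | vu]; last by rewrite (le_trans vu up) in vp.
  by exists u; split; rewrite // (le_trans uv) // -cE.
have [||z [zp zs wz]] := IHn w _ _ wp ws.
- by move: (rank_lt yw) (rank_le wp) ryb rp; clear; lia.
- exact: le_trans ay (ltW yw).
- by exists z; split; rewrite // (le_trans (ltW yw)).
Qed.

(** For a facet F of (a, b), this says that the top element of F has the property
    q. *)
Definition through (q : pred T) b F := has (fun c => q c && (c \in F)) (low b).

Definition priority (q : pred T) b (Fs : seq {fset T}) :=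
  forall k G, k < size Fs -> G \in Fs -> through q b G ->
    ~~ through q b (nth fset0 Fs k) -> G \in take k Fs.

Lemma coatom_notin a b c e F : c \in low b -> F \in order_complex a c ->
  e \in low b -> e \notin F.
Proof.
move=> lc cF le; apply/negP => /(order_complexP _ _ _ cF).1 /andP[_ /rank_lt].
by rewrite ltnNge -ltnS -(rank_low le) (rank_low lc) leqnn.
Qed.

Lemma through_cone a b c q F : c \in low b -> F \in order_complex a c ->
  through q b (c |` F) = q c.
Proof.
move=> lc cF; apply/hasP/idP => [[e le /andP[qe]] | qc]; last first.
  by exists c; rewrite // qc !inE eqxx.
rewrite !inE => /predU1P[<- // |].
by rewrite (negPf (coatom_notin lc cF le)).
Qed.

(** A facet below s can be moved below p as soon as its top element is covered
    by p too.  When s covers a, the only facet below s or below p is empty. *)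
Lemma facet_shared a p s F : rank p = rank s -> (a < p)%O -> (a < s)%O ->
    facet (order_complex a s) F ->
    (rank s <= (rank a).+1) || through (mem (low p)) s F ->
  facet (order_complex a p) F.
Proof.
move=> rps ap as_ fF; have [rs _ | rs /= /hasP[z lz /andP[/= lpz zF]]] := leqP.
  by apply/facet_fset0; rewrite ?rps //; apply/(facet_fset0 F rs).
have /(facet_coneP _ rs (ltW as_))[e [E [le ae fE FE]]] := fF.
have ze : z = e.
  move: zF; rewrite FE !inE => /predU1P[// | ].
  by rewrite (negPf (coatom_notin le fE.1 lz)).
apply/facet_coneP; [by rewrite rps | exact: ltW | ].
by exists e, E; split=> //; rewrite -ze.
Qed.

Definition connected_below a b := forall x y, (a <= x)%O -> (x <= y)%O ->
  (y <= b)%O -> 3 <= rank y - rank x -> complex_connected (order_complex x y).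

(** The freedom in the choice of q is what the induction needs: the facets below
    the second coatom s are ordered with priority to those that can be moved
    below the first coatom p. *)
Lemma ordered_facets a b (q : pred T) : (a <= b)%O -> connected_below a b ->
  exists Fs : seq {fset T},
  [/\ uniq Fs, forall F, F \in Fs <-> facet (order_complex a b) F,
      exchange Fs & priority q b Fs].
Proof.
have [n] := ubnP (rank b); elim: n b q => // n IHn b q; rewrite ltnS => rb ab conn.
have [rab | rab] := leqP (rank b) (rank a).+1.
  exists [:: fset0]; split=> // [F | [|//] _ G //| [|//] G _]; rewrite ?inE.
  - by rewrite facet_fset0 //; split=> /eqP.
  - by move/eqP=> -> ->.
have {}IHn c (r : pred T) : c \in low b -> (a < c)%O ->
    exists Fs : seq {fset T},
    [/\ uniq Fs, forall F, F \in Fs <-> facet (order_complex a c) F,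
        exchange Fs & priority r c Fs].
  move=> lc ac; apply: IHn; [by have := rank_low lc; lia | exact: ltW | ].
  by move=> x y ax xy yc; apply: conn; rewrite // (le_trans yc) // ltW // low_lt.
have notinF c e (Fs : seq {fset T}) : c \in low b -> e \in low b ->
    (forall F, F \in Fs <-> facet (order_complex a c) F) ->
    forall F, F \in Fs -> e \notin F.
  move=> lc le FsE F /FsE[cF _].
  exact: coatom_notin cF le.
have uniq_cone c (Fs : seq {fset T}) :
    (forall F, F \in Fs -> c \notin F) -> uniq Fs -> uniq [seq c |` F | F <- Fs].
  move=> cFs uFs; rewrite map_inj_in_uniq // => F G FsF FsG eqFG.
  by rewrite -(fsetU1K (cFs F FsF)) eqFG fsetU1K ?cFs.
have [p [s [[lp ls] [ap as_] only qsp]]] := coatom_pair q rab ab.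
have [pb sb] := (low_lt lp, low_lt ls).
have coneP F : facet (order_complex a b) F <->
    exists c G, [/\ c = p \/ c = s, facet (order_complex a c) G & F = c |` G].
  rewrite facet_coneP //; split=> -[c [G]].
    by move=> [lc ac fG ->]; exists c, G; split=> //; apply: only.
  by move=> [[] -> fG ->]; [exists p, G | exists s, G].
have [Fs1 [uniq1 Fs1E ex1 _]] := IHn p pred0 lp ap.
have [Fs2 [uniq2 Fs2E ex2 prio2]] := IHn s (mem (low p)) ls as_.
have p1 := notinF _ _ _ lp lp Fs1E; have s2 := notinF _ _ _ ls ls Fs2E.
have [psE | ps] := eqVneq p s.
  subst s.
  exists [seq p |` F | F <- Fs1]; split.
  - exact: uniq_cone.
  - move=> F; rewrite coneP; split=> [/mapP[G /Fs1E fG ->] | [c [G [cp fG ->]]]].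
      by exists p, G; split=> //; left.
    by case: cp fG => -> fG; apply/map_f/Fs1E.
  - exact: exchange_cone.
  - move=> k H; rewrite size_map => k_lt /mapP[G /Fs1E[cG _] ->].
    have /(mem_nth fset0)/Fs1E[cN _] := k_lt.
    rewrite (nth_map fset0) // (through_cone _ lp cG) (through_cone _ lp cN).
    by move=> ->.
have Fs2p : forall F, F \in Fs2 -> p \notin F by apply: notinF Fs2E.
exists ([seq p |` F | F <- Fs1] ++ [seq s |` F | F <- Fs2]); split.
- rewrite cat_uniq !uniq_cone // andbT /=; apply/hasPn => _ /mapP[F F2 ->].
  apply/mapP => -[G _ /fsetP/(_ p)]; rewrite !inE eqxx (negPf ps) /=.
  by rewrite (negPf (Fs2p F F2)).
- move=> F; rewrite mem_cat coneP.
  split=> [/orP[]/mapP[G FsG ->] | [c [G [cps fG ->]]]].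
  + by exists p, G; split; [left | apply/Fs1E |].
  + by exists s, G; split; [right | apply/Fs2E |].
  + apply/orP; case: cps fG => -> fG.
      by left; apply/map_f/Fs1E.
    by right; apply/map_f/Fs2E.
- apply: exchange_cat; first exact: exchange_cone.
  move=> k; rewrite size_map => k_lt; rewrite -map_take (nth_map fset0) //.
  set F := nth fset0 Fs2 k; have F2 : F \in Fs2 by apply: mem_nth.
  have [cF maxF] := (Fs2E F).1 F2.
  have Fp := Fs2p F F2; have sF := s2 F F2.
  have att2 := ex2 k k_lt; rewrite -/F in att2.
  have attc : attaches [seq s |` G | G <- take k Fs2] (s |` F).
    by apply: attaches_cone => // G /mem_take; apply: s2.
  move=> H; rewrite mem_cat => /orP[/mapP[G G1 ->] | tH]; last first.
    have [E tE [sub cardE]] := attc H tH.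
    by exists E; rewrite // mem_cat tE orbT.
  have [cG _] := (Fs1E G).1 G1.
  have subX : (p |` G) `&` (s |` F) `<=` G `&` F.
    have sG : s \notin G by apply: notinF Fs1E _ G1.
    apply/fsubsetP => x; rewrite !inE => /andP[/predU1P[-> | xG]].
      by rewrite (negPf ps) (negPf Fp).
    by rewrite xG => /predU1P[xs | //]; rewrite -xs xG in sG.
  (* Can s be replaced by p in the facet s |` F? *)
  have [pF | npF] := boolP ((rank s <= (rank a).+1) || through (mem (low p)) s F).
    have F1 : F \in Fs1.
      have rps : rank p = rank s.
        by apply: succn_inj; rewrite -(rank_low lp) -(rank_low ls).
      exact/Fs1E/(facet_shared rps ap as_ ((Fs2E F).1 F2) pF).
    exists (p |` F); first by rewrite mem_cat map_f.
    split; first by apply/(fsubset_trans subX)/fsubsetU; rewrite fsubsetIr orbT.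
    rewrite cardfsU1 sF; congr (_.+1); congr #|` _|; apply/fsetP => x; rewrite !inE.
    by have [-> | _] := eqVneq x p; rewrite ?(negPf Fp) ?(negPf ps) //=;
       case: (x \in F); rewrite ?orbT ?andbF.
  move: npF; rewrite negb_or -ltnNge => /andP[rs npF].
  have cX : G `&` F \in order_complex a s.
    by apply: order_complex_sub cF; apply: fsubsetIr.
  have [y yX [ay Xy]] := chain_max cX.
  have [yp ys] : (y <= p)%O /\ (y <= s)%O.
    case: yX => [-> | ]; first by rewrite !ltW.
    rewrite inE => /andP[yG yF].
    have /andP[_ /ltW yp] := (order_complexP _ _ _ cG).1 y yG.
    by have /andP[_ /ltW ys] := (order_complexP _ _ _ cF).1 y yF.
  have [|z [lpz lsz yz]] := common_coatom _ lp ls ps ay yp ys.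
    by move=> x ax xb; apply: conn.
  have az : (a < z)%O.
    rewrite lt_neqAle (le_trans ay yz) andbT; apply: contraTneq rs => ->.
    by rewrite (rank_low lsz) ltnn.
  have [|L fL zXL] := @facet_order_complex a s (z |` (G `&` F)).
    apply: order_complexU; rewrite ?order_complex1 ?az ?low_lt //.
    by move=> x t; rewrite inE => /eqP-> /Xy ty; apply/ge_comparable/(le_trans ty).
  (* L has a top element covered by p, and F has not. *)
  have tL : L \in take k Fs2.
    apply: prio2 => //; first exact/Fs2E.
    apply/hasP; exists z => //=; rewrite lpz (fsubsetP zXL) //.
    by rewrite !inE eqxx.
  have [E tE [subE cardE]] := att2 L tL.
  exists (s |` E); first by rewrite mem_cat map_f ?orbT.
  split.
    apply/(fsubset_trans subX); apply: fsubset_trans (fsubsetUr _ _).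
    apply: fsubset_trans subE; rewrite fsubsetI fsubsetIr andbT.
    exact: fsubset_trans (fsubsetUr _ _) zXL.
  by rewrite cardfsI_cone ?(s2 E (mem_take tE)) // cardE cardfsU1 sF.
move=> k G; rewrite size_cat !size_map mem_cat => k_lt GFs.
have top1 F : F \in Fs1 -> through q b (p |` F) = q p.
  by move=> /Fs1E[cF _]; apply: through_cone cF.
have top2 F : F \in Fs2 -> through q b (s |` F) = q s.
  by move=> /Fs2E[cF _]; apply: through_cone cF.
rewrite nth_cat take_cat size_map; case: ltnP => k1.
  rewrite (nth_map fset0) // top1 ?mem_nth // => tG nqp.
  have nqs : ~~ q s by apply: contra nqp.
  case/orP: GFs tG => /mapP[F Fs12 ->].
    by rewrite top1 // (negPf nqp).
  by rewrite top2 // (negPf nqs).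
have k2 : k - size Fs1 < size Fs2 by rewrite ltn_subLR.
rewrite (nth_map fset0) // top2 ?mem_nth // mem_cat => tG nqs.
case/orP: GFs tG => /mapP[F Fs12 ->]; first by rewrite map_f.
by rewrite top2 // (negPf nqs).
Qed.

Lemma connected_shellable a b : (a <= b)%O -> connected_below a b ->
  shellable (order_complex a b).
Proof.
move=> ab conn; have [Fs [uFs FsE exFs _]] := ordered_facets pred0 ab conn.
have dimF F : facet (order_complex a b) F ->
    face_dim F = ((rank b - rank a).-1%:Z - 1)%R.
  by move=> fF; rewrite /face_dim (card_facet ab fF).
exists ((rank b - rank a).-1%:Z - 1)%R; split.
  split=> //; have [H fH _] := facet_order_complex (order_complex_fset0 a b).
  by exists H.
by exists Fs; apply: shelling_exchange => // F /FsE/dimF.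
Qed.

End TwoCoatoms.

(** * Connected subintervals of a shellable interval *)

(** A chain K that is maximal among those with each element <= x or >= y contains
    x and y, unless these are ends of the interval, since both are
    comparable to all of K.  So K cuts down every chain that contains it to the
    open interval (x, y). *)
Lemma frame_exists a b x y : (a <= x)%O -> (x <= y)%O -> (y <= b)%O ->
  exists K : {fset T},
  [/\ K \in order_complex a b,
      forall z, z \in K -> (z <= x)%O \/ (y <= z)%O
    & forall F z, F \in order_complex a b -> K `<=` F -> z \in F ->
        z \notin K -> (x < z < y)%O].
Proof.
move=> ax xy yb.
pose outer : {pred {fset T}} := [pred F : {fset T} | (F \in order_complex a b) &&
  all (fun z => (z <= x)%O || (y <= z)%O) F].
have [||K [oK maxK] _] := @facet_extension _ outer (rank b) fset0.
- by move=> G; rewrite inE => /andP[/card_chain].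
- by rewrite inE order_complex_fset0; apply/allP => z; rewrite inE.
have [cK /allP outK] := andP oK.
have cmp_in (u z : T) : z \in K -> (x <= u)%O -> (u <= y)%O -> (u >=< z)%O.
  move=> /outK/orP[zx xu _|yz _ uy].
    exact/ge_comparable/(le_trans zx).
  exact/le_comparable/(le_trans uy).
have addK u : (a < u < b)%O -> (u <= x)%O || (y <= u)%O ->
    (forall z, z \in K -> (u >=< z)%O) -> u \in K.
  move=> aub uout cmpu; suff <- : u |` K = K by rewrite !inE eqxx.
  apply: maxK; last exact: fsubsetUr.
  rewrite inE; apply/andP; split.
    apply: order_complexU; rewrite ?order_complex1 //.
    by move=> v z; rewrite inE => /eqP->; apply: cmpu.
  apply/allP => z; rewrite !inE => /predU1P[-> // |]; exact: outK.
exists K; split=> // [z /outK/orP // | F z cF KF zF zK].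
have /order_complexP[Fab Fcmp] := cF; have /andP[az zb] := Fab z zF.
have zKcmp u : u \in K -> (z >=< u)%O by move=> uK; exact: Fcmp zF (fsubsetP KF u uK).
have /norP[zx yz] : ~~ ((z <= x)%O || (y <= z)%O).
  by apply: contra zK => zout; apply: addK; rewrite ?az.
have zx' : (z >=< x)%O.
  have [<- | nax] := eqVneq a x; first exact/ge_comparable/ltW.
  have [xb | xb] := eqVneq x b; first by rewrite xb in zx; rewrite ltW in zx.
  apply: zKcmp; apply: addK; rewrite ?lexx //.
    by rewrite !lt_neqAle nax ax xb (le_trans xy yb).
  by move=> u uK; apply: cmp_in.
have zy' : (z >=< y)%O.
  have [-> | nyb] := eqVneq y b; first exact/le_comparable/ltW.
  have [ya | ya] := eqVneq a y; first by rewrite -ya ltW in yz.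
  apply: zKcmp; apply: addK; rewrite ?lexx ?orbT //.
    by rewrite !lt_neqAle nyb ya yb (le_trans ax xy).
  by move=> u uK; apply: cmp_in.
rewrite !lt_leAnge (negPf zx) (negPf yz) !andbT.
by move: zx' zy'; rewrite /Order.comparable (negPf zx) (negPf yz) /= => -> /orP[].
Qed.

(** Facets containing K have at least two elements in (x, y), so the
    codimension-one intersection with an earlier facet still has one; this
    element links the facet to the earlier one. *)
Lemma shellable_connected a b x y :
    (a <= x)%O -> (x <= y)%O -> (y <= b)%O -> 3 <= rank y - rank x ->
  shellable (order_complex a b) -> complex_connected (order_complex x y).
Proof.
move=> ax xy yb r3 [d [[_ dimC] [Fs [uFs FsE att]]]].
have [K [cK outK midK]] := frame_exists ax xy yb.
have addF F : F \in order_complex x y -> F `|` K \in order_complex a b.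
  move=> cF; have /order_complexP[Fxy Fcmp] := cF.
  apply: order_complexU => //.
    apply/order_complexP; split=> // z /Fxy/andP[xz zy].
    by rewrite (le_lt_trans ax) // (lt_le_trans zy).
  move=> u z /Fxy/andP[xu uy] /outK[zx | yz].
    exact/ge_comparable/ltW/(le_lt_trans zx).
  exact/le_comparable/ltW/(lt_le_trans uy).
have outN z : (x < z < y)%O -> z \notin K.
  move=> /andP[xz zy]; apply/negP => /outK[zx | yz].
    by rewrite (lt_geF xz) in zx.
  by rewrite (lt_geF zy) in yz.
have cardK F : facet (order_complex a b) F -> K `<=` F -> #|` K|.+2 <= #|` F|.
  move=> [cF maxF] KF; have /order_complexP[Fab Fcmp] := cF.
  have fFK : facet (order_complex x y) (F `\` K).
    split.
      apply/order_complexP; split=> [z | z t]; rewrite !inE.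
        by move=> /andP[zK zF]; exact: midK cF KF zF zK.
      by move=> /andP[_ zF] /andP[_ tF]; apply: Fcmp.
    move=> G cG FKG; apply/eqP; rewrite eqEfsubset FKG andbT.
    have GKF : G `|` K = F.
      apply: maxF; first exact: addF.
      by rewrite fsetUC -fsubDset.
    apply/fsubsetP => z zG; rewrite !inE -GKF !inE zG andbT outN //.
    exact: (order_complexP _ _ _ cG).1.
  have := card_facet xy fFK; rewrite cardfsD (fsetIidPr KF).
  by move: r3; clear; lia.
have facetU z : (x < z < y)%O ->
    exists k, [/\ k < size Fs, K `<=` nth fset0 Fs k & z \in nth fset0 Fs k].
  move=> xzy; have [|H fH zKH] := @facet_order_complex a b ([fset z] `|` K).
    by apply: addF; rewrite order_complex1.
  have /(nthP fset0)[k k_lt kH] := (FsE H).2 fH; exists k; rewrite kH; split=> //.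
    exact: fsubset_trans (fsubsetUr _ _) zKH.
  by apply: (fsubsetP zKH); rewrite !inE eqxx.
pose edge := fun u v : T => [fset u; v] \in order_complex x y.
pose link u v := exists2 r, path edge u r & last u r = v.
have link_trans u v w : link u v -> link v w -> link u w.
  by move=> [r pr <-] [t pt <-]; exists (r ++ t); rewrite ?cat_path ?pr ?last_cat.
have link_face k u v : k < size Fs -> K `<=` nth fset0 Fs k ->
    u \in nth fset0 Fs k -> v \in nth fset0 Fs k -> u \notin K -> v \notin K ->
    link u v.
  move=> k_lt KF uF vF uK vK; exists [:: v] => //=; rewrite andbT /edge.
  have [cF _] := (FsE _).1 (mem_nth fset0 k_lt).
  rewrite order_complex2 (midK _ u cF KF uF uK) (midK _ v cF KF vF vK) /=.
  exact: (order_complexP _ _ _ cF).2.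
have ex0 : exists k, (k < size Fs) && (K `<=` nth fset0 Fs k).
  have [H fH KH] := facet_order_complex cK.
  have /(nthP fset0)[k k_lt kH] := (FsE H).2 fH.
  by exists k; rewrite k_lt kH.
(* The first facet that contains K. *)
have [i /andP[i_lt Ki] min_i] := ex_minnP ex0.
have link_first u v k : k < size Fs -> K `<=` nth fset0 Fs k ->
    u \in nth fset0 Fs k -> u \notin K ->
    v \in nth fset0 Fs i -> v \notin K -> link u v /\ link v u.
  elim/ltn_ind: k u => k IHk u k_lt Kk uk uK vi vK.
  have: i <= k by apply: min_i; rewrite k_lt.
  rewrite leq_eqVlt => /predU1P[ik | ik].
    by subst k; split; apply: (@link_face i).
  set F := nth fset0 Fs k in Kk uk *.
  have fF : facet (order_complex a b) F by apply/FsE/mem_nth.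
  (* The intersection with the first facet contains K, so K extends to a facet
     of the attaching complex, of codimension one in F. *)
  have [||A fA iA] := @facet_extension _ (attaching_complex (take k Fs) F)
      #|` F| (nth fset0 Fs i `&` F).
  - by move=> G; rewrite inE => /andP[_]; apply: fsubset_leq_card.
  - rewrite inE fsubsetIr andbT; apply/hasP; exists (nth fset0 Fs i).
      by rewrite -(nth_take _ ik) mem_nth // size_takel // ltnW.
    exact: fsubsetIl.
  have /att[_ dimA] : 0 < k < size Fs by rewrite k_lt (leq_ltn_trans _ ik).
  have KA : K `<=` A by apply: fsubset_trans iA; rewrite fsubsetI Ki Kk.
  have [z zA zK] : exists2 z, z \in A & z \notin K.
    apply/fsubsetPn/negP => /fsubset_leq_card.
    move: (cardK F fF Kk) (dimC F fF) (dimA A fA); rewrite /face_dim; clear.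
    lia.
  have [] := fA; rewrite inE => /andP[/hasP[H tH AH] AF] _.
  have [l lk lH] : exists2 l, l < k & nth fset0 Fs l = H.
    have /(nthP fset0)[l] := tH; rewrite size_takel ?(ltnW k_lt) // => lk.
    by rewrite nth_take // => lH; exists l.
  have [zv vz] : link z v /\ link v z.
    apply: (IHk l) => //; rewrite ?lH ?(ltn_trans lk) //.
      exact: fsubset_trans AH.
    exact: fsubsetP AH _ _.
  have zF := fsubsetP AF z zA.
  split; first by apply: link_trans zv; apply: link_face Kk _ _ _ _.
  by apply: link_trans vz _; apply: link_face Kk _ _ _ _.
move=> u v; rewrite !order_complex1 => xuy xvy.
have [j [j_lt Kj uj]] := facetU u xuy; have [k [k_lt Kk vk]] := facetU v xvy.
have [w wi wK] : exists2 w, w \in nth fset0 Fs i & w \notin K.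
  apply/fsubsetPn/negP => /fsubset_leq_card leF.
  have := leq_trans (cardK _ ((FsE _).1 (mem_nth fset0 i_lt)) Ki) leF.
  by rewrite ltnNge leqnSn.
have [uw _] := link_first u w j j_lt Kj uj (outN u xuy) wi wK.
have [_ wv] := link_first v w k k_lt Kk vk (outN v xvy) wi wK.
exact: link_trans uw wv.
Qed.
End Poset.

(** * The consecutive pattern poset *)

Lemma reduction_oneline_uniq (s : seq nat) :
  0 < size s -> uniq s -> is_oneline (reduction s).
Proof.
move=> s0 us; rewrite /is_oneline size_reduction s0 /=.
have inj : {in s &, injective (fun x => count (fun y => y <= x) s)}.
  suff lt x y : y \in s -> x < y ->
      count (fun z => z <= x) s < count (fun z => z <= y) s.
    move=> x y xs ys /= eqxy.
    by case: (ltngtP x y) => // [/(lt _ _ ys) | /(lt _ _ xs)]; rewrite eqxy ltnn.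
  move=> ys xy; rewrite -[X in _ < X]size_filter.
  rewrite -(count_predC (fun z => z <= x)) !count_filter -addn1 leq_add //.
    by apply: sub_count => z /= zx; rewrite zx (leq_trans zx (ltnW xy)).
  by rewrite -has_count; apply/hasP; exists y; rewrite //= -ltnNge xy leqnn.
have ur : uniq (reduction s) by rewrite map_inj_in_uniq.
apply: uniq_perm; rewrite ?iota_uniq //.
apply: (uniq_min_size _ _ _).2 => //; last by rewrite size_iota size_reduction.
move=> _ /mapP[x xs ->]; rewrite mem_iota add1n ltnS count_size andbT.
by rewrite -has_count; apply/hasP; exists x => /=.
Qed.

Definition coatoms (t : cperm) : seq cperm :=
  pmap insub [:: window t 1 (size t).-1; window t 2 (size t)].

Lemma oneline_uniq (t : cperm) : uniq t.
Proof. by case: t => s /= /andP[_ /perm_uniq->]; apply: iota_uniq. Qed.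

Lemma oneline_gt0 (t : cperm) : 0 < size t.
Proof. by case: t => s /= /andP[]. Qed.

Lemma oneline_window (t : cperm) i j :
  0 < i -> i <= j -> j <= size t -> is_oneline (window t i j).
Proof.
move=> i0 ij jt; apply: reduction_oneline_uniq.
  by rewrite -size_reduction size_window //; lia.
exact/drop_uniq/take_uniq/oneline_uniq.
Qed.

Lemma mem_coatoms (t c : cperm) : (c \in coatoms t) =
  (oneline c == window t 1 (size t).-1) || (oneline c == window t 2 (size t)).
Proof. by rewrite mem_pmap_sub !inE. Qed.

Lemma size_coatoms t : size (coatoms t) <= 2.
Proof. by rewrite size_pmap; apply: leq_trans (count_size _ _) _. Qed.

Lemma rank_coatoms (t c : cperm) : c \in coatoms t -> size t = (size c).+1.
Proof.
have := oneline_gt0 c; have := oneline_gt0 t.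
by rewrite mem_coatoms => t0 c0 /orP[] /eqP ce; move: c0;
   rewrite ce size_window //; lia.
Qed.

(** An occurrence of s in t that misses the first or the last letter of t is an
    occurrence in the corresponding window of length one less. *)
Lemma lt_coatoms (s t : cperm) :
  (s < t)%O = has (fun c => (s <= c)%O) (coatoms t).
Proof.
apply/idP/hasP => [st | [c ct sc]]; last first.
  rewrite lt_neqAle; apply/andP; split.
    apply: contraTneq ct => <-; apply/negP => /rank_coatoms.
    by have := cperm_le_size sc; lia.
  apply: le_trans sc _; apply/cperm_leP; have := rank_coatoms ct.
  have := oneline_gt0 c; move: ct; rewrite mem_coatoms => /orP[]/eqP ce c0 sz.
    by exists 1, (size t).-1; split=> //; lia.
  by exists 2, (size t); split=> //; lia.
have /cperm_leP[i [j [i1 ij jt se]]] := ltW st.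
have sub k l : 0 < k -> k <= i -> j <= l -> l <= size t ->
    forall c : cperm, oneline c = window t k l -> (s <= c)%O.
  move=> k0 ki jl lt c ce; apply/cperm_leP; exists (i - k).+1, (j - k).+1.
  rewrite ce size_window //; split; try by lia.
  by rewrite window_window //; [rewrite se; congr window; lia | lia].
have /orP[j1 | i2] : (j <= (size t).-1) || (2 <= i).
  case: (leqP 2 i) => [_ | i1']; rewrite ?orbT ?orbF //.
  have jt' : j != size t; last by lia.
  apply: contraTneq st => je; suff -> : s = t by rewrite ltxx.
  by apply/val_inj; rewrite /= se je -[RHS]window_full; congr window; lia.
- have w1 : is_oneline (window t 1 (size t).-1).
    by apply: oneline_window; lia.
  exists (CPerm w1); first by rewrite mem_coatoms eqxx.
  by apply: (sub 1 (size t).-1) => //; lia.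
have w2 : is_oneline (window t 2 (size t)).
  by apply: oneline_window; lia.
exists (CPerm w2); first by rewrite mem_coatoms eqxx orbT.
by apply: (sub 2 (size t)).
Qed.

Theorem theorem4p3 (sigma tau : cperm) (sigma_le_tau : (sigma <= tau)%O) :
  interval_shellable sigma tau <->
  ~ exists alpha beta : cperm,
      [/\ (sigma <= alpha)%O, (alpha <= beta)%O, (beta <= tau)%O
        & nontrivial_disconnected alpha beta].
Proof.
split=> [shell [a [b [sa ab bt [disc r3]]]] | nodisc].
  apply: disc.
  exact: (shellable_connected lt_coatoms rank_coatoms sa ab bt r3 shell).
apply: (connected_shellable lt_coatoms rank_coatoms size_coatoms) => //.
move=> a b sa ab bt r3; apply: NNPP => disc.
by apply: nodisc; exists a, b.
Qed.
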